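(* Consider, for $n\to\infty$, uniformly random directed hypergraphs with $n$ vertices and degree sequences $((d_v^{\mathrm{out}},d_v^{\mathrm{in}})_{v\in V},(\delta_e^{\mathrm{tail}},\delta_e^{\mathrm{head}})_{e\in E})$ (depending on $n$), and let $S_n$ be the number of self-loops. Suppose $\delta_e^{\mathrm{tail}}=\delta_e^{\mathrm{head}}=\delta$ for all $e\in E$, with $\delta\in O(1)$, and 1. $\mathbb{E}[(d_U^{\mathrm{in}}d_U^{\mathrm{out}})^{\delta}] \in o(n)$; 2. there exists $c>0$ such that $\mathbb{P}(d_U^{\mathrm{out}}\ge\delta \text{ and } d_U^{\mathrm{in}} \geq \delta) \geq c$. Then $$\mathbb{E}[S_n] = (\delta-1)!\; n\, \mathbb{E}[d_U^{\mathrm{in}}] \left( \frac{\mathbb{E}[d_U^{\mathrm{in}}d_U^{\mathrm{out}}]}{n\,\mathbb{E}[d_U^{\mathrm{in}}]^2} \right)^{\delta} (1+o(1)).$$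
   Context: All asymptotics are as $n=|V|\to\infty$, along a sequence of degree sequences. Let $V$ be a finite vertex set with $n=|V|$ and $E$ a finite set of (labelled) hyperedges. A directed degree sequence consists of vertex out- and in-degrees $d_v^{\mathrm{out}},d_v^{\mathrm{in}}\in\mathbb{N}$ ($v\in V$) and hyperedge tail- and head-degrees $\delta_e^{\mathrm{tail}},\delta_e^{\mathrm{head}}\in\mathbb{N}$ ($e\in E$) with $\sum_v d_v^{\mathrm{out}}=\sum_e\delta_e^{\mathrm{tail}}$ and $\sum_v d_v^{\mathrm{in}}=\sum_e\delta_e^{\mathrm{head}}$. A uniformly random (stub-labeled) directed hypergraph with this degree sequence is obtained as follows: each vertex $v$ has $d_v^{\mathrm{out}}$ distinguishable out-stubs and $d_v^{\mathrm{in}}$ distinguishable in-stubs; all out-stubs are distributed over the tails so that the tail of $e$ receives exactly $\delta_e^{\mathrm{tail}}$ out-stubs, and all in-stubs are distributed over the heads so that the head of $e$ receives exactly $\delta_e^{\mathrm{head}}$ in-stubs (slots within a tail or head are interchangeable); all such pairs of assignments are equally likely (so the out- and in-assignments are independent and uniform). Each hyperedge is then a pair $e=(e^{\mathrm{tail}},e^{\mathrm{head}})$ of multisets of vertices, where multiplicities count the stubs of a vertex in the tail and in the head. A hyperedge $e$ is a self-loop if $e^{\mathrm{tail}}=e^{\mathrm{head}}$ as multisets; $S_n$ is the number of self-loops. $U$ is a uniformly chosen vertex of $V$, with out-degree $d_U^{\mathrm{out}}$ and in-degree $d_U^{\mathrm{in}}$. *)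

(* Defs.v *)
From HB Require Import structures.
From mathcomp Require Import all_boot all_order all_algebra.
From mathcomp Require Import finmap multiset.
From mathcomp Require Import all_classical all_reals all_analysis.
Set Implicit Arguments.
Unset Strict Implicit.
Unset Printing Implicit Defensive.
Import Order.TTheory GRing.Theory Num.Theory.
Import numFieldNormedType.Exports.
Local Open Scope ring_scope.

(* Expectation and probability under the uniform distribution on A; both are
   0 by convention when A is empty. *)
Definition unif_expect (R : realType) (T : finType) (A : {set T}) (X : T -> R)
  : R := (\sum_(w in A) X w) / #|A|%:R.

Definition unif_prob (R : realType) (T : finType) (A : {set T}) (P : pred T)
  : R := #|[set w in A | P w]|%:R / #|A|%:R.

Record degree_sequence := DegreeSequence {
  vertex : finType;
  hyperedge : finType;
  dout : vertex -> nat;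
  din : vertex -> nat;
  dtail : hyperedge -> nat;
  dhead : hyperedge -> nat;
  sum_dout : (\sum_v dout v = \sum_e dtail e)%N;
  sum_din : (\sum_v din v = \sum_e dhead e)%N
}.

Section Assignment.
Variables (V E : finType) (d : V -> nat) (k : E -> nat).

(* The pair (v, i) is the i-th stub of v. *)
Definition stub : finType := {v : V & 'I_(d v)}.

(* Slots are interchangeable, so an assignment only records, for each stub,
   the hyperedge that receives it. *)
Definition assignments : {set {ffun stub -> E}} :=
  [set f : {ffun stub -> E} | [forall e, #|[set s | f s == e]| == k e]].

Definition side (f : {ffun stub -> E}) (e : E) : {mset V}%mset :=
  seq_mset [seq tag s | s <- enum [set s | f s == e]].

End Assignment.

Section DirectedHypergraph.
Variable D : degree_sequence.

Definition out_assignment : finType :=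
  {ffun stub (@dout D) -> hyperedge D}.
Definition in_assignment : finType :=
  {ffun stub (@din D) -> hyperedge D}.

Definition hypergraph : finType := (out_assignment * in_assignment)%type.

Definition hypergraphs : {set hypergraph} :=
  finset.setX (assignments (@dout D) (@dtail D))
              (assignments (@din D) (@dhead D)).

Definition edge_tail (H : hypergraph) (e : hyperedge D) : {mset vertex D}%mset :=
  side H.1 e.
Definition edge_head (H : hypergraph) (e : hyperedge D) : {mset vertex D}%mset :=
  side H.2 e.

Definition num_self_loops (H : hypergraph) : nat :=
  #|[set e | edge_tail H e == edge_head H e]|.

End DirectedHypergraph.

Definition expect_self_loops (R : realType) (D : degree_sequence) : R :=
  unif_expect (hypergraphs D) (fun H => (num_self_loops H)%:R).

Definition expect_vertex (R : realType) (D : degree_sequence)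
    (X : vertex D -> nat) : R :=
  unif_expect [set: vertex D] (fun v => (X v)%:R).

Definition prob_vertex (R : realType) (D : degree_sequence)
    (P : pred (vertex D)) : R :=
  unif_prob R [set: vertex D] P.

(* Main.v *)
Require Import Defs.
From HB Require Import structures.
From mathcomp Require Import all_boot all_order all_algebra.
From mathcomp Require Import perm.
From mathcomp Require Import finmap multiset.
From mathcomp Require Import all_classical all_reals all_analysis.
From mathcomp Require Import ring lra.
Set Implicit Arguments.
Unset Strict Implicit.
Unset Printing Implicit Defensive.
Import Order.TTheory GRing.Theory Num.Theory.
Import numFieldNormedType.Exports.
Local Open Scope ring_scope.

(** Write [r] for the common size of all tails and heads, [m] for the number of
out-stubs (which is also the number of in-stubs), and [x v] for the product of
the in- and out-degree of [v].

The tail of a fixed hyperedge [e] is a uniformly random [r]-subset of the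
out-stubs ([expect_fibre]), its head is an independent uniform [r]-subset of the
in-stubs, and [e] is a self-loop when the two subsets carry the same multiset of
vertices. If [Q] denotes the number of pairs of [r]-subsets that do, then the
expected number of self-loops is exactly [#|E| * Q / 'C(m, r) ^ 2]
([expect_self_loopsE]).

To estimate [Q], consider the set [P] of pairs (out-stub, in-stub) at the same
vertex; it has [X = \sum_v x v] elements. A pair of [r]-subsets with the same
vertex multiset is the pair of projections of some [r]-subset of [P], obtained
by matching the stubs vertex by vertex. Hence [Q <= 'C(X, r)]
([matched_draws_le]). Conversely an [r]-subset of [P] meeting every vertex at
most once is determined by its two projections, so [Q] is at least ['C(X, r)]
minus the number of [r]-subsets of [P] that meet some vertex twice. A union
bound over the colliding pairs of elements of [P], at most [\sum_v x v ^ 2] of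
them, shows that the latter is a fraction at most
[r * (r - 1) * \sum_v x v ^ 2 / (X * (X - 1))] of all [r]-subsets
([matched_draws_ge]).

The second hypothesis provides linearly many vertices with [x v >= 1] and with
positive in-degree, so that [X] and [m] are at least [c * n]. For [r >= 2] we
have [x v ^ 2 <= x v ^ r], and the first hypothesis bounds [\sum_v x v ^ r] by
[o(n ^ 2)], so the fraction tends to 0; for [r = 1] it vanishes. Therefore
[Q ~ 'C(X, r)]. As [r] is bounded while [X] and [m] tend to infinity, the
binomials may be replaced by [X ^ r / r!] and [m ^ r / r!]
([cvg_ffact_ratio]), which gives the announced equivalent because
[#|E| * r! = m * (r - 1)!]. *)

(** * Fibres of a uniform assignment *)

(** Listing [S] before its complement, and likewise for [S'], gives two
orderings of [T]; the permutation sends each entry of the first to the entry of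
the second at the same position. *)
Lemma perm_mapping_set (T : finType) (S S' : {set T}) :
  #|S| = #|S'| -> exists p : {perm T}, p @: S = S'.
Proof.
move=> eqS.
pose r (X : {set T}) := enum X ++ enum (~: X)%SET.
have r_uniq X : uniq (r X).
  rewrite cat_uniq !enum_uniq andbT /=; apply/hasPn => x.
  by rewrite !mem_enum finset.inE.
have mem_r X x : x \in r X.
  by rewrite mem_cat !mem_enum finset.inE orbN.
have size_r X : size (r X) = #|T|.
  by rewrite size_cat -!cardE finset.cardsC.
pose g x := nth x (r S') (index x (r S)).
have idx_lt x : (index x (r S) < size (r S'))%N.
  by rewrite size_r -(size_r S) index_mem.
have g_inj : injective g.
  move=> x y; rewrite /g (set_nth_default y) // => /eqP.
  rewrite nth_uniq // => /eqP eq_idx.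
  by rewrite -(nth_index x (mem_r S x)) eq_idx nth_index.
exists (perm g_inj); apply/eqP; rewrite eqEcard card_imset; last exact: perm_inj.
rewrite eqS leqnn andbT; apply/fintype.subsetP => _ /imsetP[x xS ->].
have idx_S : (index x (r S) < #|S|)%N.
  by rewrite index_cat mem_enum xS cardE index_mem mem_enum.
rewrite permE /g nth_cat -cardE -eqS idx_S.
by rewrite -(@mem_enum _ (mem S')) mem_nth // -cardE -eqS.
Qed.

Lemma card_stub (V : finType) (d : V -> nat) : #|stub d| = (\sum_v d v)%N.
Proof.
rewrite card_tagged sumnE !big_map -!enumT !big_enum /=.
by under eq_bigr do rewrite card_ord.
Qed.

Section UniformFibre.
Variables (V E : finType) (d : V -> nat) (k : E -> nat).
Implicit Types (f : {ffun stub d -> E}) (S : {set stub d}).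

Definition fibre f (e : E) : {set stub d} := [set s | f s == e].

(** The hyperedges have slots just as the vertices have stubs, and there are as
many slots as stubs: any bijection between the two is an assignment. *)
Lemma assignments_neq0 :
  (\sum_v d v = \sum_e k e)%N -> (0 < #|assignments d k|)%N.
Proof.
move=> eq_sum.
have same_card : #|stub d| = #|stub k| by rewrite !card_stub.
pose h (s : stub d) : {e : E & 'I_(k e)} :=
  enum_val (cast_ord same_card (enum_rank s)).
have h_inj : injective h.
  by move=> x y /enum_val_inj /cast_ord_inj /enum_rank_inj.
have h_bij : bijective h by apply: (inj_card_bij h_inj); rewrite same_card.
have [h' hK h'K] := h_bij.
apply/card_gt0P; exists [ffun s => tag (h s)].
rewrite finset.inE; apply/forallP => e.
pose slot (i : 'I_(k e)) := h' (Tagged (fun e => 'I_(k e)) i).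
rewrite -[X in _ == X]card_ord -(card_imset predT (f := slot)); last first.
  by move=> i j /(can_inj h'K) /eqP; rewrite eq_Tagged => /eqP.
apply/eqP/eq_card => s; rewrite finset.inE ffunE.
apply/eqP/imsetP => [|[i _ ->]]; last by rewrite h'K.
case: (h s) (hK s) => e' i /= <- ee'; subst e'; by exists i.
Qed.

(** Permuting the stubs permutes the assignments, since only the sizes of the
fibres are prescribed. *)
Lemma card_fibre_fixed e S S' : #|S| = #|S'| ->
  #|[set f in assignments d k | fibre f e == S]|
    = #|[set f in assignments d k | fibre f e == S']|.
Proof.
suff le_card (X Y : {set stub d}) : #|X| = #|Y| ->
  (#|[set f in assignments d k | fibre f e == X]|
    <= #|[set f in assignments d k | fibre f e == Y]|)%N.
  by move=> eqS; apply/eqP; rewrite eqn_leq !le_card.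
case/perm_mapping_set => p pXY.
pose g f : {ffun stub d -> E} := [ffun s => f ((p^-1)%g s)].
have fibre_g f e' : fibre (g f) e' = p @: fibre f e'.
  apply/setP => s; rewrite -(permKV p s) mem_imset; last exact: perm_inj.
  by rewrite !finset.inE ffunE permK.
have g_inj : injective g.
  move=> f f' /ffunP eq_g; apply/ffunP => s.
  by have := eq_g (p s); rewrite !ffunE permK.
rewrite -(card_imset _ g_inj); apply/subset_leq_card/fintype.subsetP.
move=> _ /imsetP[f + ->]; rewrite !finset.inE => /andP[/forallP f_ass /eqP f_X].
rewrite fibre_g f_X pXY eqxx andbT; apply/forallP => e'.
have := fibre_g f e'; rewrite /fibre => ->.
by rewrite card_imset //; exact: perm_inj.
Qed.

(** The fibre over [e] of a uniform assignment is a uniform [k e]-subset of the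
stubs: each such subset is the fibre of the same number [c] of assignments, and
[c] cancels. *)
Lemma expect_fibre (R : realType) (F : {set stub d} -> R) e :
  (\sum_v d v = \sum_e k e)%N ->
  unif_expect (assignments d k) (fun f => F (fibre f e))
    = unif_expect [set S : {set stub d} | #|S| == k e] F.
Proof.
move=> /assignments_neq0 ass_gt0; rewrite /unif_expect.
have [f0 f0_ass] := card_gt0P ass_gt0.
have card_fib f : f \in assignments d k -> #|fibre f e| == k e.
  by rewrite finset.inE => /forallP/(_ e).
pose c := #|[set f in assignments d k | fibre f e == fibre f0 e]|.
have sumE (G : {set stub d} -> R) :
  \sum_(f in assignments d k) G (fibre f e)
    = c%:R * \sum_(S in [set S : {set stub d} | #|S| == k e]) G S.
  rewrite (partition_big (fibre^~ e) (mem [set S : {set stub d} | #|S| == k e])) /=;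
    last by move=> f; rewrite [in X in _ -> X]finset.inE; exact: card_fib.
  rewrite big_distrr /=; apply: eq_bigr => S; rewrite finset.inE => /eqP S_card.
  rewrite (eq_bigr (fun=> G S)); last by move=> f /andP[_ /eqP ->].
  rewrite sumr_const -[LHS]mulr_natl; congr (_%:R * _).
  rewrite /c (card_fibre_fixed e (S' := S)); last first.
    by rewrite S_card; apply/eqP/card_fib.
  by apply: eq_card => f; rewrite [RHS]finset.inE.
have := sumE (fun=> 1); rewrite !sumr_const => ->; rewrite sumE.
have c_neq0 : c%:R != 0 :> R.
  rewrite pnatr_eq0 -lt0n; apply/card_gt0P; exists f0.
  by rewrite finset.inE f0_ass eqxx.
by rewrite invfM mulrACA divff // mul1r.
Qed.

End UniformFibre.

Lemma unif_expect_setX (R : realType) (S T : finType) (A : {set S}) (B : {set T})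
    (X : S -> T -> R) :
  unif_expect (finset.setX A B) (fun w => X w.1 w.2)
    = unif_expect A (fun a => unif_expect B (X a)).
Proof.
rewrite /unif_expect cardsX natrM invfM -mulr_suml -mulrA.
rewrite [_^-1 / _ in RHS]mulrC; congr (_ * _).
by rewrite pair_big /=; apply: eq_bigl => w; rewrite finset.inE.
Qed.

Definition matched_draws (V A B : finType) (tA : A -> V) (tB : B -> V) (r : nat)
    : {set {set A} * {set B}} :=
  [set ST : {set A} * {set B} | [&& #|ST.1| == r, #|ST.2| == r &
     perm_eq (map tA (enum ST.1)) (map tB (enum ST.2))]].

(** By linearity of expectation and the independence of the two assignments:
every hyperedge is a self-loop with the same probability, that of two
independent uniform [r]-subsets of stubs having equal vertex multisets. *)
Lemma expect_self_loopsE (R : realType) (D : degree_sequence) (r : nat)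
    (tailE : forall e : hyperedge D, dtail e = r)
    (headE : forall e : hyperedge D, dhead e = r) :
  expect_self_loops R D =
    #|hyperedge D|%:R *
    (#|matched_draws (@tag _ _ : stub (@dout D) -> vertex D)
                     (@tag _ _ : stub (@din D) -> vertex D) r|%:R
      / ('C(#|hyperedge D| * r, r)%:R ^+ 2)).
Proof.
have stub_out : #|stub (@dout D)| = (#|hyperedge D| * r)%N.
  by rewrite card_stub sum_dout; under eq_bigr do rewrite tailE; rewrite sum_nat_const.
have stub_in : #|stub (@din D)| = (#|hyperedge D| * r)%N.
  by rewrite card_stub sum_din; under eq_bigr do rewrite headE; rewrite sum_nat_const.
have card_draws_of (T : finType) : #|[set S : {set T} | #|S| == r]| = 'C(#|T|, r).
  rewrite -cardsT -cards_draws; apply: eq_card => S.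
  by rewrite !finset.inE finset.subsetT.
pose mtags (T : finType) (t : T -> vertex D) (S : {set T}) :=
  seq_mset [seq t s | s <- enum S].
transitivity (\sum_(e : hyperedge D) unif_expect (hypergraphs D)
  (fun H => (edge_tail H e == edge_head H e)%:R : R)).
  rewrite /expect_self_loops /unif_expect -mulr_suml; congr (_ / _).
  rewrite exchange_big /=; apply: eq_bigr => H _.
  rewrite /num_self_loops -sum1_card natr_sum big_mkcond /=.
  by apply: eq_bigr => e _; rewrite finset.inE; case: ifP.
rewrite (eq_bigr (fun=> #|matched_draws (@tag _ _ : stub (@dout D) -> vertex D)
                     (@tag _ _ : stub (@din D) -> vertex D) r|%:R
      / ('C(#|hyperedge D| * r, r)%:R ^+ 2))); last first.
  move=> e _.
  rewrite [LHS](unif_expect_setX _ _ (fun f g => (side f e == side g e)%:R)).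
  pose G (S : {set stub (@dout D)}) : R :=
    unif_expect [set T : {set stub (@din D)} | #|T| == r]
      (fun T => (mtags _ tag S == mtags _ tag T)%:R).
  transitivity (unif_expect (assignments (@dout D) (@dtail D))
                  (fun f => G (fibre f e))).
    rewrite /unif_expect; congr (_ / _); apply: eq_bigr => f _.
    have := @expect_fibre _ _ (@din D) (@dhead D) R
      (fun T => (side f e == mtags _ tag T)%:R) e (sum_din D).
    by rewrite headE.
  rewrite (expect_fibre G e (sum_dout D)) tailE /G.
  rewrite -(unif_expect_setX _ _ (fun S T => (mtags _ tag S == mtags _ tag T)%:R)).
  rewrite /unif_expect cardsX !card_draws_of stub_out stub_in natrM; congr (_ / _).
  rewrite -sum1_card natr_sum big_mkcond [RHS]big_mkcond /=.
  apply: eq_bigr => -[S T] _; rewrite !finset.inE /=.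
  case: (_ == r) => //; case: (_ == r) => //=.
  have -> : (mtags _ tag S == mtags _ tag T) =
    perm_eq [seq tag i | i <- enum S] [seq tag i | i <- enum T].
    by apply/eqP/idP => /eq_seq_msetP.
  by case: perm_eq.
rewrite sumr_const -[LHS]mulr_natl; congr (_%:R * _); exact: eq_card.
Qed.

(** * Counting pairs of draws with the same multiset of labels *)

(** Two sequences whose labels agree up to order can be paired off so that
partners have the same label. *)
Lemma perm_map_zip (A B V : eqType) (f : A -> V) (g : B -> V) (s : seq A) (t : seq B) :
  perm_eq (map f s) (map g t) ->
  exists u : seq (A * B), [/\ map fst u = s, perm_eq (map snd u) t &
    all (fun p => f p.1 == g p.2) u].
Proof.
elim: s t => [|a s IHs] t.
  by move=> /perm_size; case: t => // _; exists [::].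
move=> st; have : f a \in map g t by rewrite -(perm_mem st) mem_head.
case/mapP => b bt fa_gb.
have t_rem : perm_eq t (b :: rem b t) by exact: perm_to_rem.
have : perm_eq (map f s) (map g (rem b t)).
  by rewrite -(perm_cons (f a)) {2}fa_gb (perm_trans st) // (perm_map g t_rem).
case/IHs => u [us ut u_match]; exists ((a, b) :: u); split=> /=.
- by rewrite us.
- by rewrite perm_sym (perm_trans t_rem) // perm_cons perm_sym.
- by rewrite fa_gb eqxx.
Qed.

Section MatchedDraws.
Variables (V A B : finType) (tA : A -> V) (tB : B -> V).
Implicit Types (W : {set A * B}) (p q : A * B).

Definition matched_pairs : {set A * B} := [set p | tA p.1 == tB p.2].

Let X := #|matched_pairs|.
Let x (v : V) := (#|[set a | tA a == v]| * #|[set b | tB b == v]|)%N.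

Lemma card_matched_over (v : V) :
  #|[set p in matched_pairs | tA p.1 == v]| = x v.
Proof.
rewrite /x -cardsX; apply: eq_card => p; rewrite !finset.inE.
by case: (eqVneq (tA p.1) v) => [->|]; rewrite ?andbT ?andbF // eq_sym.
Qed.

Lemma card_matched_pairs : X = (\sum_v x v)%N.
Proof.
rewrite /X -sum1_card (partition_big (fun p => tA p.1) xpredT) //=.
apply: eq_bigr => v _; rewrite -card_matched_over -sum1_card.
by apply: eq_bigl => p; rewrite [RHS]finset.inE.
Qed.

(** Pairing off the elements of [S] and [T] with equal labels yields an
[r]-subset of [matched_pairs] whose projections are [S] and [T]; so the
projections map the [r]-subsets of [matched_pairs] onto a set containing all
matched draws. *)
Lemma matched_draws_le (r : nat) : (#|matched_draws tA tB r| <= 'C(X, r))%N.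
Proof.
rewrite -cards_draws.
pose proj W := (fst @: W, snd @: W).
apply: leq_trans (leq_imset_card proj _); apply/subset_leq_card/fintype.subsetP.
case=> S T; rewrite finset.inE /= => /and3P[/eqP Sr _ /perm_map_zip[u [uS uT u_match]]].
have u_uniq : uniq u by apply: (@map_uniq _ _ fst); rewrite uS enum_uniq.
apply/imsetP; exists [set p in u].
  rewrite finset.inE; apply/andP; split.
    apply/fintype.subsetP => p; rewrite !finset.inE; exact: (allP u_match).
  by rewrite cardsE (card_uniqP u_uniq) -(size_map fst) uS -cardE Sr.
congr pair; apply/setP => y.
  rewrite -mem_enum -uS; apply/mapP/imsetP => -[p pu ->]; exists p => //.
    by rewrite finset.inE.
  by move: pu; rewrite finset.inE.
rewrite -mem_enum -(perm_mem uT); apply/mapP/imsetP => -[p pu ->]; exists p => //.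
  by rewrite finset.inE.
by move: pu; rewrite finset.inE.
Qed.

Let label p := tA p.1.

Let good r : {set {set A * B}} :=
  [set W : {set A * B} | [&& W \subset matched_pairs, #|W| == r & #|label @: W| == #|W|]].

(** When its labels are distinct, [W] is recovered from its projections: an
element of the first projection has a unique partner in the second one with the
same label. *)
Lemma good_draws_le r : (#|good r| <= #|matched_draws tA tB r|)%N.
Proof.
pose proj W := (fst @: W, snd @: W).
have enum_imset (C : finType) (h : A * B -> C) W : {in W &, injective h} ->
    perm_eq (enum (h @: W)) (map h (enum W)).
  move=> h_inj; apply: uniq_perm; first exact: enum_uniq.
    rewrite map_inj_in_uniq ?enum_uniq // => p q.
    by rewrite !mem_enum; exact: h_inj.
  move=> y; rewrite mem_enum; apply/imsetP/mapP => -[p pW ->]; exists p => //.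
    by rewrite mem_enum.
  by rewrite -mem_enum.
have sub_tB W p : W \subset matched_pairs -> p \in W -> tA p.1 = tB p.2.
  by move=> /fintype.subsetP/(_ p) sub /sub; rewrite finset.inE => /eqP.
have proj_inj : {in good r &, injective proj}.
  have sub W W' : W \in good r -> W' \in good r -> proj W = proj W' -> W \subset W'.
    rewrite !finset.inE => /and3P[W_sub _ _] /and3P[W'_sub _ /imset_injP W'_inj].
    case=> e1 e2; apply/fintype.subsetP => -[s t] stW.
    have := imset_f fst stW; rewrite e1 => /imsetP[p pW' /= ps].
    have := imset_f snd stW; rewrite e2 => /imsetP[q qW' /= qt].
    have p_q : p = q.
      apply: W'_inj => //; rewrite /label -ps (sub_tB W' q) // -qt.
      exact: (sub_tB W (s, t)).
    by rewrite ps qt -p_q -surjective_pairing.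
  move=> W W' Wg W'g eq_proj; apply/eqP; rewrite finset.eqEsubset.
  by rewrite !sub.
rewrite -(card_in_imset proj_inj); apply/subset_leq_card/fintype.subsetP.
move=> _ /imsetP[W + ->]; rewrite !finset.inE /=.
case/and3P => W_sub /eqP W_r /imset_injP W_inj.
have fst_inj : {in W &, injective fst}.
  by move=> p q pW qW pq; apply: W_inj => //; rewrite /label pq.
have snd_inj : {in W &, injective snd}.
  move=> p q pW qW pq; apply: W_inj => //.
  by rewrite /label (sub_tB W p) // pq -(sub_tB W q).
rewrite !card_in_imset // W_r eqxx /=.
rewrite (perm_trans (perm_map tA (enum_imset _ _ _ fst_inj))) //.
rewrite perm_sym (perm_trans (perm_map tB (enum_imset _ _ _ snd_inj))) //.
rewrite -!map_comp; have -> // : map (tB \o snd) (enum W) = map (tA \o fst) (enum W).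
by apply/eq_in_map => p; rewrite mem_enum => pW /=; rewrite (sub_tB W p).
Qed.

(** Union bound over the pairs [p != q] in [matched_pairs] with equal labels: a
fraction [r * (r - 1) / (X * (X - 1))] of the [r]-subsets contains both [p] and
[q]. The inequality is multiplied by [X * (X - 1)] to stay in the natural
numbers. *)
Lemma matched_draws_ge r :
  (X * X.-1 * 'C(X, r) <= X * X.-1 * #|matched_draws tA tB r|
     + r * r.-1 * (\sum_v x v ^ 2) * 'C(X, r))%N.
Proof.
pose collide : {set (A * B) * (A * B)} :=
  [set pq | [&& pq.1 \in matched_pairs, pq.2 \in matched_pairs, pq.1 != pq.2 &
                label pq.1 == label pq.2]].
pose over (pq : (A * B) * (A * B)) : {set {set A * B}} :=
  [set W : {set A * B} | [&& W \subset matched_pairs, #|W| == r, pq.1 \in W & pq.2 \in W]].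
have draws_split : ('C(X, r) <= #|good r| + \sum_(pq in collide) #|over pq|)%N.
  (* A subset that is not good contains two elements with the same label. *)
  rewrite -(cards_draws matched_pairs) -[leqLHS](cardsID (good r)) leq_add //.
    by apply/subset_leq_card/finset.subsetIr.
  under [leqRHS]eq_bigr do rewrite -sum1_card big_mkcond.
  rewrite exchange_big /= -sum1_card big_mkcond leq_sum //= => W _.
  rewrite !finset.inE; case: ifP => // /andP[W_bad /andP[W_sub W_r]].
  move: W_bad; rewrite W_sub W_r /= => W_bad.
  have /dinjectivePn[p pW [q]] : ~~ dinjectiveb label (mem W).
    by apply: contra W_bad => /dinjectiveP/imset_injP.
  rewrite !finset.inE => /andP[q_p qW] pq.
  have pq_collide : (p, q) \in collide.
    by rewrite finset.inE /= !(fintype.subsetP W_sub) //= eq_sym q_p pq eqxx.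
  by rewrite (bigD1 _ pq_collide) /= finset.inE W_sub W_r /= pW qW.
have card_collide : (#|collide| <= \sum_v x v ^ 2)%N.
  rewrite -sum1_card (partition_big (fun pq => label pq.1) xpredT) //=.
  apply: leq_sum => v _; rewrite sum1_card -mulnn -card_matched_over -cardsX.
  apply/subset_leq_card/fintype.subsetP => -[p q].
  rewrite unfold_in /= !finset.inE /= => /andP[/and4P[-> -> _ /eqP pq] pv].
  by rewrite pv /= -[tA q.1]pq.
have card_over pq : pq \in collide ->
    (X * X.-1 * #|over pq| <= r * r.-1 * 'C(X, r))%N.
  case: pq => p q; rewrite finset.inE /= => /and4P[pX qX p_q _].
  case: (leqP 2 r) => [|r_lt2]; last first.
    suff -> : over (p, q) = finset.set0 by rewrite cards0 muln0.
    apply/setP => W; rewrite !finset.inE /=; apply/and4P => -[_ /eqP W_r pW qW].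
    have : [set p; q] \subset W by rewrite finset.subUset !finset.sub1set pW.
    by move/subset_leq_card; rewrite cards2 p_q W_r; rewrite leqNgt r_lt2.
  case: r @over {draws_split} => [|[|r]] // over _.
  have card_rest : #|matched_pairs :\ p :\ q| = X.-2.
    have := cardsD1 q (matched_pairs :\ p); have := cardsD1 p matched_pairs.
    by rewrite /X pX finset.in_setD1 eq_sym p_q qX /= !add1n => -> /= ->.
  have over_le : (#|over (p, q)| <= 'C(X.-2, r))%N.
    rewrite -card_rest -cards_draws.
    (* Deleting [p] and [q] leaves a draw from the remaining pairs. *)
    have del_inj : {in over (p, q) &, injective (fun W : {set A * B} => W :\ p :\ q)}.
      move=> W W'; rewrite !finset.inE /= => /and4P[_ _ pW qW] /and4P[_ _ pW' qW'] eqW.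
      rewrite -(finset.setD1K pW) -(finset.setD1K pW'); congr (_ |: _).
      have qW1 : q \in W :\ p by rewrite !finset.inE eq_sym p_q.
      have qW1' : q \in W' :\ p by rewrite !finset.inE eq_sym p_q.
      by rewrite -(finset.setD1K qW1) -(finset.setD1K qW1') eqW.
    rewrite -(card_in_imset del_inj); apply/subset_leq_card/fintype.subsetP.
    move=> _ /imsetP[W + ->]; rewrite !finset.inE /= => /and4P[W_sub /eqP W_r pW qW].
    rewrite !finset.setSD //=.
    have := cardsD1 q (W :\ p); have := cardsD1 p W.
    by rewrite pW !finset.inE eq_sym p_q qW /= W_r !add1n => -[<-] [<-].
  apply: (leq_trans (leq_mul (leqnn _) over_le)).
  by rewrite -mulnA mul_bin_diag mulnCA mul_bin_diag mulnCA mulnA.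
apply: (@leq_trans (X * X.-1 * (#|good r| + \sum_(pq in collide) #|over pq|))).
  by rewrite leq_mul2l draws_split orbT.
rewrite mulnDr leq_add ?leq_mul2l ?good_draws_le ?orbT //.
rewrite big_distrr /=; apply: leq_trans (leq_sum _ card_over) _.
by rewrite sum_nat_const [leqRHS]mulnAC [leqLHS]mulnC leq_mul2l card_collide orbT.
Qed.

End MatchedDraws.

(** * Falling factorials and powers *)

(** The ratio is the product of the factors [1 - i / m] for [i < r], and
[\sum_(i < r) i <= r ^ 2]. *)
Lemma ffact_ratio_bounds (R : realType) (m r : nat) : (r <= m)%N ->
  (1 - r%:R ^+ 2 / m%:R <= (m ^_ r)%:R / m%:R ^+ r :> R) /\
  ((m ^_ r)%:R / m%:R ^+ r <= 1 :> R).
Proof.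
elim: r => [|r IHr] r_le; first by rewrite ffactn0 expr0 divr1 expr0n mul0r subr0.
have m_gt0 : 0 < m%:R :> R by rewrite ltr0n (leq_trans _ r_le).
have [lb ub] := IHr (ltnW r_le).
have -> : (m ^_ r.+1)%:R / m%:R ^+ r.+1
    = (m ^_ r)%:R / m%:R ^+ r * (1 - r%:R / m%:R) :> R.
  rewrite ffactnSr natrM natrB ?(ltnW r_le) // exprSr.
  by field; rewrite gt_eqF //= expf_neq0 // gt_eqF.
have r_m : 0 <= r%:R / m%:R :> R by rewrite divr_ge0.
have r_m1 : r%:R / m%:R <= 1 :> R by rewrite ler_pdivrMr // mul1r ler_nat ltnW.
set y := (m ^_ r)%:R / _ in lb ub *; have y_ge0 : 0 <= y by rewrite divr_ge0 // exprn_ge0.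
split; last by nra.
(* [(r + 1) ^ 2 = r ^ 2 + r + (r + 1)]: the induction step uses up [r], and
   the remaining [r + 1] is dropped. *)
have -> : r.+1%:R ^+ 2 / m%:R
    = r%:R ^+ 2 / m%:R + (r%:R / m%:R + (r%:R + 1) / m%:R) :> R.
  by rewrite -natr1; field; rewrite gt_eqF.
have : 0 <= (r%:R + 1) / m%:R :> R by rewrite divr_ge0 ?addr_ge0.
nra.
Qed.

(** * Quantities attached to a degree sequence *)

Lemma card_stubs_at (V : finType) (d : V -> nat) (v : V) :
  #|[set s : stub d | tag s == v]| = d v.
Proof.
pose at_v (i : 'I_(d v)) : stub d := Tagged (fun v => 'I_(d v)) i.
rewrite -[RHS]card_ord -(card_imset predT (f := at_v)).
  apply: eq_card => s; rewrite finset.inE; apply/eqP/imsetP => [|[i _ ->] //].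
  by case: s => w i /= wv; subst w; exists i.
by move=> i j /eqP; rewrite eq_Tagged => /eqP.
Qed.

Section DegreeSequence.
Variables (R : realType) (D : degree_sequence) (r : nat).
Hypothesis r_gt0 : (0 < r)%N.
Hypothesis tailE : forall e : hyperedge D, dtail e = r.
Hypothesis headE : forall e : hyperedge D, dhead e = r.

Local Notation n := #|vertex D|.
Local Notation m := (#|hyperedge D| * r)%N.

Definition degree_product (v : vertex D) : nat := (din v * dout v)%N.
Local Notation x := degree_product.
Definition num_pairs : nat := \sum_v x v.

Definition num_matched : nat :=
  #|matched_draws (@tag _ _ : stub (@dout D) -> vertex D)
                  (@tag _ _ : stub (@din D) -> vertex D) r|.

Lemma sum_din_const : (\sum_v @din D v)%N = m.
Proof. by rewrite sum_din; under eq_bigr do rewrite headE; rewrite sum_nat_const. Qed.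

Lemma expect_vertexE (f : vertex D -> nat) :
  expect_vertex R f = (\sum_v f v)%:R / n%:R.
Proof.
rewrite /expect_vertex /unif_expect cardsT natr_sum; congr (_ / _).
by apply: eq_bigl => v; rewrite finset.inE.
Qed.

Lemma num_matched_bounds : (r <= num_pairs)%N -> (1 < num_pairs)%N ->
  1 - r%:R * r.-1%:R * (\sum_v x v ^ 2)%:R / (num_pairs%:R * num_pairs.-1%:R)
    <= num_matched%:R / 'C(num_pairs, r)%:R :> R /\
  num_matched%:R / 'C(num_pairs, r)%:R <= 1 :> R.
Proof.
move=> r_le X_gt1.
have xE v : (#|[set s : stub (@dout D) | tag s == v]| *
   #|[set s : stub (@din D) | tag s == v]|)%N = x v.
  by rewrite !card_stubs_at mulnC.
pose t_out := @tag _ _ : stub (@dout D) -> vertex D.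
pose t_in := @tag _ _ : stub (@din D) -> vertex D.
have XE : #|matched_pairs t_out t_in| = num_pairs.
  by rewrite card_matched_pairs; apply: eq_bigr.
have ub := matched_draws_le t_out t_in r.
have lb := matched_draws_ge t_out t_in r.
rewrite XE -/num_matched in ub lb.
rewrite (eq_bigr (fun v => x v ^ 2)%N) in lb; last by move=> v _; rewrite xE.
have C_gt0 : 0 < 'C(num_pairs, r)%:R :> R by rewrite ltr0n bin_gt0.
have XX_gt0 : 0 < num_pairs%:R * num_pairs.-1%:R :> R.
  by rewrite -natrM ltr0n muln_gt0 -subn1 subn_gt0 X_gt1 (ltnW X_gt1).
split; last by rewrite ler_pdivrMr // mul1r ler_nat.
rewrite lerBlDr -(ler_pM2r C_gt0) mul1r mulrDl divfK ?gt_eqF //.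
rewrite -(ler_pM2l XX_gt0) mulrDr -!natrM.
rewrite mulrAC mulrCA divff ?gt_eqF ?natrM // mulr1 -!natrM -natrD ler_nat.
by [].
Qed.

(** The quotient of the exact expectation by its announced equivalent, arranged
as a product of three quantities each of which tends to 1: the factors compare
the matched draws with all draws from the pairs of stubs, ['C(X, r)] with
[X ^ r / r!], and (inverted and squared, for tail and head) ['C(m, r)] with
[m ^ r / r!]. *)
Definition self_loop_ratio : R :=
  num_matched%:R / 'C(num_pairs, r)%:R
  * ((num_pairs ^_ r)%:R / num_pairs%:R ^+ r)
  * ((m ^_ r)%:R / m%:R ^+ r)^-1 ^+ 2.

Lemma expect_self_loops_ratio :
  (0 < n)%N -> (r <= num_pairs)%N -> (0 < m)%N ->
  expect_self_loops R D =
    r.-1`!%:R * n%:R * expect_vertex R (@din D)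
    * (expect_vertex R x / (n%:R * expect_vertex R (@din D) ^+ 2)) ^+ r
    * self_loop_ratio.
Proof.
move=> n_gt0 r_X m_gt0.
have r_m : (r <= m)%N by move: m_gt0; rewrite muln_gt0 => /andP[M_gt0 _]; exact: leq_pmull.
rewrite (expect_self_loopsE R tailE headE) !expect_vertexE sum_din_const -/num_pairs.
rewrite -/num_matched /self_loop_ratio -!bin_ffact.
have n0 : n%:R != 0 :> R by rewrite pnatr_eq0 -lt0n.
have m0 : m%:R != 0 :> R by rewrite pnatr_eq0 -lt0n.
have X0 : num_pairs%:R != 0 :> R by rewrite pnatr_eq0 -lt0n (leq_trans r_gt0).
have CX0 : 'C(num_pairs, r)%:R != 0 :> R by rewrite pnatr_eq0 -lt0n bin_gt0.
have Cm0 : 'C(m, r)%:R != 0 :> R by rewrite pnatr_eq0 -lt0n bin_gt0.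
have f0 : r.-1`!%:R != 0 :> R by rewrite pnatr_eq0 -lt0n fact_gt0.
have r0 : r%:R != 0 :> R by rewrite pnatr_eq0 -lt0n.
have simpl_base (a b c : R) : b != 0 -> c != 0 ->
    a / b / (b * (c / b) ^+ 2) = a / c ^+ 2 by move=> b0 c0; field; rewrite b0 c0.
rewrite simpl_base // expr_div_n -exprM [(2 * r)%N]mulnC exprM.
have -> : r`! = (r * r.-1`!)%N by case: r r_gt0.
rewrite !natrM; rewrite natrM in m0.
have Xr0 := expf_neq0 r X0; have mr0 := expf_neq0 r m0.
set Xr := num_pairs%:R ^+ r in Xr0 *; set mr := (_ * r%:R) ^+ r in mr0 *.
by field; rewrite ?n0 ?Xr0 ?mr0 ?CX0 ?Cm0 ?f0 ?r0.
Qed.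

(** The vertices counted by the second hypothesis: each contributes at least 1
both to [num_pairs] and to the number of in-stubs, whence the two lower bounds
below. *)
Definition num_good : nat :=
  #|[set v : vertex D | (r <= dout v)%N && (r <= din v)%N]|.

Lemma num_good_le_pairs : (num_good <= num_pairs)%N.
Proof.
rewrite /num_good /num_pairs -sum1_card big_mkcond /=; apply: leq_sum => v _.
rewrite finset.inE /degree_product; case: ifP => // /andP[out_ge in_ge].
by rewrite muln_gt0 !(leq_trans r_gt0).
Qed.

Lemma num_good_le_stubs : (num_good <= m)%N.
Proof.
rewrite -sum_din_const /num_good -sum1_card big_mkcond /=; apply: leq_sum => v _.
by rewrite finset.inE; case: ifP => // /andP[_]; exact: leq_trans.
Qed.

Lemma prob_goodE : prob_vertex R
    (fun v : vertex D => (r <= dout v)%N && (r <= din v)%N) = num_good%:R / n%:R.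
Proof.
rewrite /prob_vertex /unif_prob cardsT; congr (_%:R / _).
by apply: eq_card => v; rewrite !finset.inE.
Qed.

(** The factor [r * (r - 1)] makes the comparison of the second moment with the
[r]-th one hold for [r = 1] as well. *)
Lemma second_moment_le :
  (r * r.-1 * (\sum_v x v ^ 2) <= r * r.-1 * (\sum_v x v ^ r))%N.
Proof.
case: r r_gt0 => [|[|k]] // _.
rewrite leq_mul2l; apply/orP; right; apply: leq_sum => v _.
by case: (x v) => [|y]; rewrite ?exp0n // leq_pexp2l.
Qed.

End DegreeSequence.

(** * Asymptotics *)

Local Open Scope classical_set_scope.

Lemma cvg_one_of_defect (R : realType) (C : R) (f h : nat -> R) :
  (\forall k \near \oo, 1 - C * h k <= f k <= 1) ->
  h @ \oo --> 0 -> f @ \oo --> (1 : R).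
Proof.
move=> f_bounds h0; apply: (squeeze_cvgr f_bounds); last exact: cvg_cst.
have := cvgB (cvg_cst (1 : R)) (cvgMl_tmp (a := C) h0).
by rewrite mulr0 subr0; apply.
Qed.

Lemma cvg_ffact_ratio (R : realType) (K : R) (m r : nat -> nat) :
  (fun k => (m k)%:R : R) @ \oo --> +oo ->
  (\forall k \near \oo, (r k)%:R <= K) ->
  (fun k => (m k ^_ r k)%:R / (m k)%:R ^+ r k) @ \oo --> (1 : R).
Proof.
move=> m_oo r_K.
have m_gt (c : R) : \forall k \near \oo, c < (m k)%:R by move/cvgryPgt: m_oo; apply.
apply: (@cvg_one_of_defect _ (K ^+ 2) _ (fun k => (m k)%:R^-1)); last first.
  by apply/gtr0_cvgV0 => //; exact: m_gt.
near=> k.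
have r_le_K : (r k)%:R <= K by near: k.
have r_le_m : (r k <= m k)%N.
  by rewrite -(ler_nat R) (le_trans r_le_K) // ltW //; near: k; exact: m_gt.
have [lb ub] := ffact_ratio_bounds R r_le_m.
rewrite ub andbT (le_trans _ lb) // lerB // ler_wpM2r ?invr_ge0 //.
by apply: lerXn2r; rewrite ?nnegrE // (le_trans _ r_le_K).
Unshelve. all: by end_near. Qed.


Theorem lemma5p1 (R : realType) (D : nat -> degree_sequence)
    (delta : nat -> nat)
    (n_infty : (fun k => #|vertex (D k)|) @ \oo --> \oo)
    (delta_gt0 : forall k, (0 < delta k)%N)
    (tailE : forall k (e : hyperedge (D k)), dtail e = delta k)
    (headE : forall k (e : hyperedge (D k)), dhead e = delta k)
    (delta_O1 : (fun k => (delta k)%:R : R) =O_\oo (fun _ => 1 : R))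
    (moment_o : (fun k => expect_vertex R
                  (fun v : vertex (D k) => (din v * dout v) ^ delta k)%N)
                =o_\oo (fun k => #|vertex (D k)|%:R : R))
    (deg_ge : exists2 c : R, 0 < c & \forall k \near \oo,
       c <= prob_vertex R (fun v : vertex (D k) =>
              (delta k <= dout v)%N && (delta k <= din v)%N)) :
  exists2 eps : nat -> R, eps =o_\oo (fun _ => 1 : R) &
    \forall k \near \oo,
      let n : R := #|vertex (D k)|%:R in
      let Ein := expect_vertex R (fun v : vertex (D k) => din v) in
      let Einout :=
        expect_vertex R (fun v : vertex (D k) => (din v * dout v)%N) in
      expect_self_loops R (D k) =
        ((delta k).-1)`!%:R * n * Ein * (Einout / (n * Ein ^+ 2)) ^+ delta k
          * (1 + eps k).
Proof.
have [c c_gt0 good_ge_c] := deg_ge.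
have [K K_gt0 delta_K'] : exists2 K : R, 0 < K & \forall k \near \oo, (delta k)%:R <= K.
  have /eqO_exP[K K_gt0 leK] := delta_O1; exists K => //.
  apply: filterS leK => k; by rewrite normr1 mulr1 ger0_norm.
pose n k : R := #|vertex (D k)|%:R.
pose X k := num_pairs (D k).
pose m k := (#|hyperedge (D k)| * delta k)%N.
pose mom k := expect_vertex R (fun v : vertex (D k) => (din v * dout v) ^ delta k)%N.
have n_oo : n @ \oo --> +oo by apply/cvgrnyP.
have n_gt (A : R) : \forall k \near \oo, A < n k by move/cvgryPgt: n_oo; apply.
have good_ge : \forall k \near \oo, c * n k <= (num_good (D k) (delta k))%:R.
  near=> k; have n0 : 0 < n k by near: k; exact: n_gt.
  by rewrite -ler_pdivlMr // -prob_goodE; near: k.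
have cn_oo : (fun k => c * n k) @ \oo --> +oo.
  apply/cvgryPge => A; near=> k; rewrite mulrC -ler_pdivrMr //.
  by apply: ltW; near: k; exact: n_gt.
have cn_le_X : \forall k \near \oo, c * n k <= (X k)%:R.
  apply: filterS good_ge => k /le_trans; apply.
  by rewrite ler_nat num_good_le_pairs.
have cn_le_m : \forall k \near \oo, c * n k <= (m k)%:R.
  apply: filterS good_ge => k /le_trans; apply.
  by rewrite ler_nat num_good_le_stubs.
have X_oo : (fun k => (X k)%:R : R) @ \oo --> +oo by exact: ger_cvgy cn_oo.
have m_oo : (fun k => (m k)%:R : R) @ \oo --> +oo by exact: ger_cvgy cn_oo.
have X_gt (A : R) : \forall k \near \oo, A < (X k)%:R by move/cvgryPgt: X_oo; apply.
have m_gt (A : R) : \forall k \near \oo, A < (m k)%:R by move/cvgryPgt: m_oo; apply.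
have delta_le_X : \forall k \near \oo, (delta k <= X k)%N.
  near=> k; rewrite -(ler_nat R) (@le_trans _ _ K) //; first by near: k.
  by apply: ltW; near: k; exact: X_gt.
have mom_n : (fun k => mom k / n k) @ \oo --> 0.
  apply/cvgr0Pnorm_le => e e_gt0; near=> k.
  have n0 : 0 < n k by near: k; exact: n_gt.
  rewrite normrM normfV [X in _ / X]gtr0_norm // ler_pdivrMr //.
  rewrite -[X in e * X]gtr0_norm //; near: k.
  by have /eqoP/(_ e e_gt0) := moment_o.
have matched_cvg :
  (fun k => (num_matched (D k) (delta k))%:R / 'C(X k, delta k)%:R) @ \oo --> (1 : R).
  apply: (@cvg_one_of_defect _ (2 * K ^+ 2 / c ^+ 2)) mom_n.
  near=> k.
  have n0 : 0 < n k by near: k; exact: n_gt.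
  have X_ge2 : 2 < (X k)%:R :> R by near: k; exact: X_gt.
  have X_gt1 : (1 < X k)%N by rewrite -(ltr_nat R) (lt_trans _ X_ge2) // ltr_nat.
  have cnX : c * n k <= (X k)%:R by near: k.
  have delta_K : (delta k)%:R <= K by near: k.
  have delta_X : (delta k <= X k)%N by near: k.
  have [lb ub] := num_matched_bounds R delta_X X_gt1.
  rewrite ub andbT; apply: le_trans lb; rewrite lerB //.
  (* [X >= 2] gives [X - 1 >= X / 2]; this is where the constant 2 in the
     bound on the defect comes from. *)
  have XX_ge : (c * n k) ^+ 2 / 2 <= (X k)%:R * (X k).-1%:R.
    have -> : (X k).-1%:R = (X k)%:R - 1 :> R by rewrite -subn1 natrB // ltnW.
    have : 0 < c * n k by rewrite mulr_gt0.
    nra.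
  have cn2_gt0 : 0 < (c * n k) ^+ 2 / 2 by rewrite divr_gt0 // exprn_gt0 // mulr_gt0.
  have -> : 2 * K ^+ 2 / c ^+ 2 * (mom k / n k) = K ^+ 2 * (mom k * n k) / ((c * n k) ^+ 2 / 2).
    by field; rewrite !gt_eqF.
  have -> : mom k * n k = (\sum_v degree_product (D := D k) v ^ delta k)%:R.
    by rewrite /mom expect_vertexE divfK // gt_eqF.
  apply: ler_pM => //.
    have := second_moment_le (D k) (delta_gt0 k); rewrite -(ler_nat R) !natrM => /le_trans; apply.
    rewrite ler_wpM2r // expr2 ler_pM // (le_trans _ delta_K) // ler_nat; exact: leq_pred.
  by rewrite lef_pV2 ?posrE // (lt_le_trans cn2_gt0).
pose ratio k := self_loop_ratio R (D k) (delta k).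
have ratio_cvg : ratio @ \oo --> (1 : R).
  have f_X := cvg_ffact_ratio X_oo delta_K'.
  have f_m := cvg_ffact_ratio m_oo delta_K'.
  have f_mV : (fun k => ((m k ^_ delta k)%:R / (m k)%:R ^+ delta k)^-1) @ \oo --> (1 : R).
    by rewrite -[X in _ --> X]invr1; apply: cvgV f_m; exact: oner_neq0.
  have := cvgM (cvgM matched_cvg f_X) (cvgM f_mV f_mV).
  by rewrite !mulr1; exact.
exists (fun k => ratio k - 1).
  apply/eqolim0P.
  have := cvgB ratio_cvg (cvg_cst (1 : R)); rewrite subrr; exact.
near=> k => /=; rewrite addrC subrK.
apply: expect_self_loops_ratio => //.
- by rewrite -(ltr0n R); near: k; exact: n_gt.
- by near: k.
- by rewrite -(ltr0n R); near: k; exact: m_gt.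
Unshelve. all: by end_near. Qed.
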